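(* Let $\Omega$ be a set, let $A\subset\mathbb R$ be finite with $0\in A$, and let $X\subset\ell_\infty(\Omega)$ be a closed subspace. If $\{x_n\}_{n=1}^\infty\subset X$ is a normalized weakly null sequence such that $x_n(\omega)\in A$ for all $(n,\omega)\in\mathbb N\times\Omega$, then there is a subsequence $\{x_{n_k}\}_{k=1}^\infty$ which generates a spreading model whose closed linear span is nonreflexive.
   Context: All Banach spaces are real. $\ell_\infty(\Omega)$ is the Banach space of bounded real-valued functions on $\Omega$ with the supremum norm. Normalized means $\|x_n\|=1$ for all $n$; weakly null means converging weakly to $0$. A basic sequence is a sequence in a Banach space that is a Schauder basis of its closed linear span. Given a sequence $\{x_n\}$ in a Banach space and a subsequence $\{x_{m_j}\}_{j=1}^\infty$, a basic sequence $\{b_i\}_{i=1}^\infty$ (in some Banach space) is a spreading model generated by $\{x_{m_j}\}_{j=1}^\infty$ if for every $k\in\mathbb N$, all scalars $a_1,\dots,a_k$ and every $\varepsilon>0$ there exists $N\in\mathbb N$ such that $$\left|\left\|\sum_{i=1}^k a_i x_{m_{j_i}}\right\|-\left\|\sum_{i=1}^k a_i b_i\right\|\right|<\varepsilon$$ whenever $N\le j_1<\cdots<j_k$. The closed linear span of the spreading model is $\overline{\operatorname{span}}\{b_i:i\in\mathbb N\}$. *)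

(* Defs.v *)
From HB Require Import structures.
From mathcomp Require Import all_boot all_order all_algebra.
From mathcomp Require Import all_classical all_reals all_analysis.
Set Implicit Arguments.
Unset Strict Implicit.
Unset Printing Implicit Defensive.
Import Order.TTheory GRing.Theory Num.Theory.
Import numFieldNormedType.Exports.
Local Open Scope classical_set_scope.
Local Open Scope ring_scope.

Section linf_def.
Context (Omega : Type) (R : realType).

Definition bounded_pred : {pred Omega -> R} :=
  fun f => `[< bounded_fun f >].

Lemma bounded_predP (f : Omega -> R) :
  reflect (exists M : R, forall w, `|f w| <= M) (f \in bounded_pred).
Proof.
apply: (iffP (asboolP (bounded_fun f))) => [/pinfty_ex_gt0[M _ fM]|[M fM]].
  by exists M => w; exact: fM.
rewrite /= /bounded_near; near=> N => w _.
by rewrite /= (le_trans (fM w))//; near: N; exact: nbhs_pinfty_ge.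
Unshelve. all: by end_near. Qed.

Lemma bounded_pred_submod : subsemimod_closed bounded_pred.
Proof.
split; first split.
- by apply/bounded_predP; exists 0 => w; rewrite normr0.
- move=> f g /bounded_predP[M fM] /bounded_predP[N gN].
  apply/bounded_predP; exists (M + N) => w.
  by rewrite (le_trans (ler_normD _ _))// lerD.
- move=> a f /bounded_predP[M fM]; apply/bounded_predP; exists (`|a| * M) => w.
  by rewrite normrM ler_wpM2l.
Qed.

Record linf : Type := Linf { linf_val :> Omega -> R ; _ : linf_val \in bounded_pred }.

HB.instance Definition _ := [isSub for linf_val].
HB.instance Definition _ := [Choice of linf by <:].
HB.instance Definition _ :=
  GRing.SubChoice_isSubLmodule.Build R (Omega -> R) bounded_pred linf
    bounded_pred_submod.

Definition linf_norm (f : linf) : R := sup (range (fun w => `|f w|)).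

Lemma linf_norm_ub (f : linf) w : `|f w| <= linf_norm f.
Proof.
have /bounded_predP[M fM] := valP f.
apply: ub_le_sup; last by exists w.
by exists M => _ [v _ <-]; exact: fM.
Qed.

(* The bound [0 <= M] is needed when [Omega] is empty. *)
Lemma linf_norm_le (f : linf) M :
  0 <= M -> (forall w, `|f w| <= M) -> linf_norm f <= M.
Proof.
move=> M0 fM; have [[r rf]|/set0P] := pselect (range (fun w => `|f w|) !=set0).
  by apply: ge_sup; [exists r|move=> _ [w _ <-]].
by move=> /negP; rewrite negbK => /eqP; rewrite /linf_norm => ->; rewrite sup0.
Qed.

Lemma linf_norm_ge0 (f : linf) : 0 <= linf_norm f.
Proof.
have [[r [w _ _]]|/set0P] := pselect (range (fun w => `|f w|) !=set0).
  exact: le_trans (linf_norm_ub f w).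
by move=> /negP; rewrite negbK => /eqP; rewrite /linf_norm => ->; rewrite sup0.
Qed.

Lemma linf_ler_normD f g : linf_norm (f + g) <= linf_norm f + linf_norm g.
Proof.
apply: linf_norm_le => [|w]; first by rewrite addr_ge0 ?linf_norm_ge0.
by rewrite (le_trans (ler_normD _ _))// lerD ?linf_norm_ub.
Qed.

Lemma linf_normZ_le a f : linf_norm (a *: f) <= `|a| * linf_norm f.
Proof.
apply: linf_norm_le => [|w]; first by rewrite mulr_ge0 ?linf_norm_ge0.
by rewrite [leLHS]normrM ler_wpM2l// linf_norm_ub.
Qed.

Lemma linf_normZ a f : linf_norm (a *: f) = `|a| * linf_norm f.
Proof.
apply/eqP; rewrite eq_le linf_normZ_le /=.
have [->|a0] := eqVneq a 0; first by rewrite normr0 mul0r linf_norm_ge0.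
rewrite mulrC -ler_pdivlMr ?normr_gt0// mulrC -normfV.
by rewrite -{1}(scalerK a0 f) linf_normZ_le.
Qed.

Lemma linf_norm_eq0 f : linf_norm f = 0 -> f = 0.
Proof.
move=> f0; apply/val_inj/funext => w; apply/eqP; rewrite -normr_le0 -f0.
exact: linf_norm_ub.
Qed.

HB.instance Definition _ := Lmodule_isNormed.Build R linf
  linf_ler_normD linf_normZ linf_norm_eq0.

Lemma linf_complete (F : set_system linf) : ProperFilter F -> cauchy F -> cvg F.
Proof.
move=> FF /cauchyP Fc.
have ballw (f g : linf) e w : ball f e g -> `|f w - g w| < e.
  by rewrite -ball_normE; apply: le_lt_trans; exact: (linf_norm_ub (f - g) w).
have /choice[h hF] : forall w, exists r : R, (fun g : linf => g w) @ F --> r.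
  move=> w; apply/cvg_ex; apply: cauchy_cvg; apply/cauchyP => e e0.
  have [f Ff] := Fc _ e0; exists (f w).
  by apply: (@filterS _ F _ _ _ _ Ff) => g fg; rewrite /= -ball_normE; exact: ballw.
have near_h (f : linf) e : F (ball f e) -> forall w, `|f w - h w| <= e.
  move=> Ff w.
  have fh : (fun g : linf => `|f w - g w|) @ F --> `|f w - h w|.
    by apply: cvg_norm; apply: cvgB; [exact: cvg_cst|exact: hF].
  apply: (closed_cvg (fun x => x <= e) (@closed_le R e) _ _ fh).
  by apply: (@filterS _ F _ _ _ _ Ff) => g fg; exact/ltW/ballw.
have [f0 Ff0] := Fc _ ltr01.
have hb : h \in bounded_pred.
  apply/bounded_predP; exists (linf_norm f0 + 1) => w.
  rewrite -[h w](subKr (f0 w)) (le_trans (ler_normB _ _))// lerD ?linf_norm_ub//.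
  exact: near_h.
apply/cvg_ex; exists (Linf hb); apply/cvgrPdist_le => e e0.
have [f Ff] := Fc _ (divr_gt0 e0 (ltr0n R 2)).
apply: filterS (Ff) => g fg; apply: linf_norm_le => [|w]; first exact: ltW.
rewrite (_ : _ w = (h w - f w) + (f w - g w)); last by rewrite addrA subrK.
rewrite (le_trans (ler_normD _ _))// (splitr e) lerD//.
  by rewrite distrC near_h.
exact/ltW/ballw.
Qed.

HB.instance Definition _ := Uniform_isComplete.Build linf linf_complete.

End linf_def.

Section dual_def.
Context (R : realType) (V : normedModType R).

Definition dual_pred : {pred V -> R} :=
  fun f => `[< scalar f /\ continuous f >].

Lemma dual_pred_submod : subsemimod_closed dual_pred.
Proof.
split; first split.
- apply/asboolP; split; first by move=> a u v /=; rewrite mulr0 addr0.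
  by move=> v; exact: cvg_cst.
- move=> f g /asboolP[lf cf] /asboolP[lg cg]; apply/asboolP; split.
    by move=> a u v; rewrite -[LHS]/(f _ + g _) lf lg [in RHS]mulrDr addrACA.
  by move=> v; exact: (@cvgD _ R _ _ _ f g _ _ (cf v) (cg v)).
- move=> a f /asboolP[lf cf]; apply/asboolP; split.
    by move=> b u v; rewrite -[LHS]/(a * f _) lf mulrDr mulrCA.
  by move=> v; exact: (cvgM (cvg_cst a) (cf v)).
Qed.

Record dual : Type := Dual { dual_val :> V -> R ; _ : dual_val \in dual_pred }.

HB.instance Definition _ := [isSub for dual_val].
HB.instance Definition _ := [Choice of dual by <:].
HB.instance Definition _ :=
  GRing.SubChoice_isSubLmodule.Build R (V -> R) dual_pred dual dual_pred_submod.

Lemma dual_scalar (f : dual) : scalar f.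
Proof. by have /asboolP[] := valP f. Qed.

Lemma dual_continuous (f : dual) : continuous f.
Proof. by have /asboolP[] := valP f. Qed.

HB.instance Definition _ (f : dual) :=
  GRing.isLinear.Build R V R *%R f (dual_scalar f).

Definition dual_norm (f : dual) : R := sup [set `|f v| | v in [set v | `|v| <= 1]].

Lemma dual_norm_has_sup (f : dual) :
  has_sup [set `|f v| | v in [set v | `|v| <= 1]].
Proof.
split; first by exists `|f 0|, 0 => //=; rewrite normr0.
have lf : linear (dual_val f) by exact: dual_scalar.
pose g : {linear V -> R} :=
  HB.pack (dual_val f) (GRing.isLinear.Build R V R _ (dual_val f) lf).
have /linear_bounded_continuous/bounded_funP/(_ 1)[M gM] :
  continuous g by exact: dual_continuous.
by exists M => _ [v v1 <-]; exact: gM.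
Qed.

Lemma dual_norm_ub1 (f : dual) v : `|v| <= 1 -> `|f v| <= dual_norm f.
Proof. by move=> v1; apply: ub_le_sup; [case: (dual_norm_has_sup f)|exists v]. Qed.

Lemma dual_norm_le (f : dual) M :
  (forall v, `|v| <= 1 -> `|f v| <= M) -> dual_norm f <= M.
Proof.
by move=> fM; apply: ge_sup; [case: (dual_norm_has_sup f)|
  move=> _ [v v1 <-]; exact: fM].
Qed.

Lemma dual_norm_ge0 (f : dual) : 0 <= dual_norm f.
Proof. by rewrite (le_trans _ (@dual_norm_ub1 f 0 _)) ?normr0. Qed.

Lemma dual_norm_ub (f : dual) v : `|f v| <= dual_norm f * `|v|.
Proof.
have [->|v0] := eqVneq v 0; first by rewrite raddf0 !normr0 mulr0.
rewrite -ler_pdivrMr ?normr_gt0// mulrC.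
have -> : `|v|^-1 * `|f v| = `|f (`|v|^-1 *: v)|.
  by rewrite linearZ/= normrM normfV normr_id.
by apply: dual_norm_ub1; rewrite normrZ normfV normr_id mulVf ?normr_eq0.
Qed.

Lemma dual_ler_normD f g : dual_norm (f + g) <= dual_norm f + dual_norm g.
Proof.
apply: dual_norm_le => v v1.
by rewrite (le_trans (ler_normD _ _))// lerD ?dual_norm_ub1.
Qed.

Lemma dual_normZ_le a f : dual_norm (a *: f) <= `|a| * dual_norm f.
Proof.
apply: dual_norm_le => v v1.
by rewrite [leLHS]normrM ler_wpM2l// dual_norm_ub1.
Qed.

Lemma dual_normZ a f : dual_norm (a *: f) = `|a| * dual_norm f.
Proof.
apply/eqP; rewrite eq_le dual_normZ_le /=.
have [->|a0] := eqVneq a 0; first by rewrite normr0 mul0r dual_norm_ge0.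
rewrite mulrC -ler_pdivlMr ?normr_gt0// mulrC -normfV.
by rewrite -{1}(scalerK a0 f) dual_normZ_le.
Qed.

Lemma dual_norm_eq0 f : dual_norm f = 0 -> f = 0.
Proof.
move=> f0; apply/val_inj/funext => v; apply/eqP; rewrite -normr_le0.
by rewrite (le_trans (dual_norm_ub f v))// f0 mul0r.
Qed.

HB.instance Definition _ := Lmodule_isNormed.Build R dual
  dual_ler_normD dual_normZ dual_norm_eq0.

End dual_def.

(* Surjectivity of the canonical embedding of [V] into its bidual. *)
Definition reflexive_space (R : realType) (V : normedModType R) : Prop :=
  forall phi : dual (dual V), exists v : V, forall f : dual V, phi f = f v.

Definition weakly_null (R : realType) (V : normedModType R) (x : nat -> V) :=
  forall f : dual V, f (x n) @[n --> \oo] --> (0 : R).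

Record closedSubspace (R : realType) (V : normedModType R) := ClosedSubspace {
  subspace_set : set V ;
  subspace_submod : submod_closed (mem subspace_set) ;
  subspace_closed : closed subspace_set }.

(* [set_type] already carries the initial topology, hence a separate type. *)
Section subspace_type.
Context (R : realType) (V : normedModType R) (X : closedSubspace V).

Record subspace_of : Type := SubspaceOf {
  subspace_val :> V ; _ : subspace_val \in mem (subspace_set X) }.

Lemma subspace_subsemimod : subsemimod_closed (mem (subspace_set X)).
Proof. exact/GRing.submod_closed_semi/subspace_submod. Qed.

HB.instance Definition _ := [isSub for subspace_val].
HB.instance Definition _ := [Choice of subspace_of by <:].
HB.instance Definition _ :=
  GRing.SubChoice_isSubLmodule.Build R V (mem (subspace_set X)) subspace_of
    subspace_subsemimod.

Definition subspace_norm (x : subspace_of) : R := `|subspace_val x|.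

Lemma subspace_ler_normD x y :
  subspace_norm (x + y) <= subspace_norm x + subspace_norm y.
Proof. exact: ler_normD. Qed.

Lemma subspace_normZ (a : R) x : subspace_norm (a *: x) = `|a| * subspace_norm x.
Proof. exact: normrZ. Qed.

Lemma subspace_norm_eq0 x : subspace_norm x = 0 -> x = 0.
Proof. by move=> /normr0_eq0 x0; exact: val_inj. Qed.

HB.instance Definition _ := Lmodule_isNormed.Build R subspace_of
  subspace_ler_normD subspace_normZ subspace_norm_eq0.

End subspace_type.

Section subspace_complete.
Context (R : realType) (V : completeNormedModType R) (X : closedSubspace V).

Lemma subspace_complete (F : set_system (subspace_of X)) :
  ProperFilter F -> cauchy F -> cvg F.
Proof.
move=> FF /cauchyP Fc.
have /cvg_ex[v Fv] : cvg (@subspace_val R V X @ F).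
  apply: cauchy_cvg; apply/cauchyP => e e0.
  have [x Fx] := Fc _ e0; exists (subspace_val x).
  by apply: (@filterS _ F _ _ _ _ Fx) => y; rewrite /= -!ball_normE.
have Xv : v \in mem (subspace_set X).
  rewrite inE; apply: (closed_cvg _ (@subspace_closed _ _ X) _ _ Fv).
  by apply: nearW => x; have := valP x; rewrite inE.
apply/cvg_ex; exists (SubspaceOf Xv); apply/cvgrPdist_lt => e e0.
by move/cvgrPdist_lt/(_ _ e0): Fv.
Qed.

HB.instance Definition _ :=
  Uniform_isComplete.Build (subspace_of X) subspace_complete.

End subspace_complete.

Section closed_span.
Context (R : realType) (V : normedModType R) (b : nat -> V).

Definition linear_span : set V :=
  [set v | exists n (a : nat -> R), v = \sum_(i < n) a i *: b i].

Lemma linear_span_wide n m (a : nat -> R) : (n <= m)%N ->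
  \sum_(i < n) a i *: b i =
  \sum_(i < m) (if (i < n)%N then a i else 0) *: b i.
Proof.
move=> nm; rewrite (big_ord_widen _ (fun i => a i *: b i) nm) big_mkcond.
by apply: eq_bigr => i _; case: ifP; rewrite ?scale0r.
Qed.

Lemma linear_span0 : linear_span 0.
Proof. by exists 0, (fun=> 0); rewrite big_ord0. Qed.

Lemma linear_span_linear c u v :
  linear_span u -> linear_span v -> linear_span (c *: u + v).
Proof.
move=> [n [a ->]] [m [a' ->]].
rewrite (linear_span_wide _ (leq_maxl n m)) (linear_span_wide _ (leq_maxr n m)).
exists (maxn n m), (fun i => c * (if (i < n)%N then a i else 0) +
                             (if (i < m)%N then a' i else 0)).
rewrite scaler_sumr -big_split; apply: eq_bigr => i _ /=.
by rewrite scalerDl scalerA.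
Qed.

Lemma closure_span_submod : submod_closed (mem (closure linear_span)).
Proof.
split; first by rewrite !inE; exact/subset_closure/linear_span0.
move=> c u v; rewrite !inE => uS vS.
have cadd : continuous (fun z : V * V => c *: z.1 + z.2).
  move=> z; apply: cvgD; last exact: cvg_snd.
  by apply: cvgZr; exact: cvg_fst.
move=> B /(cadd (u, v))[[/= P Q] [Pu Qv] PQB].
have [u' [u'S Pu']] := uS _ Pu; have [v' [v'S Qv']] := vS _ Qv.
by exists (c *: u' + v'); split; [exact: linear_span_linear|exact: (PQB (u', v'))].
Qed.

Definition closed_span : closedSubspace V :=
  ClosedSubspace closure_span_submod (@closed_closure V linear_span).

Definition basic_sequence : Prop :=
  forall y, closure linear_span y ->
    exists! a : nat -> R, series (fun i => a i *: b i) @ \oo --> y.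

End closed_span.

Definition generates_spreading_model (R : realType) (V : normedModType R)
    (E : completeNormedModType R) (y : nat -> V) (b : nat -> E) : Prop :=
  basic_sequence b /\
  forall (k : nat) (a : 'I_k -> R) (eps : R), 0 < eps ->
    exists N : nat, forall j : 'I_k -> nat,
      {homo j : i i' / (i < i')%N} -> (forall i, (N <= j i)%N) ->
      `| `|\sum_(i < k) a i *: y (j i)| - `|\sum_(i < k) a i *: b i| | < eps.

(* Main.v *)
Require Import Defs.
From mathcomp Require Import all_boot all_order all_algebra.
From mathcomp Require Import all_classical all_reals all_analysis.
From mathcomp Require Import ring lra.
Set Implicit Arguments.
Unset Strict Implicit.
Unset Printing Implicit Defensive.
Import Order.TTheory GRing.Theory Num.Theory.
Import numFieldNormedType.Exports.
Local Open Scope classical_set_scope.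
Local Open Scope ring_scope.

(** Because the values lie in a finite set, norms are combinatorial: the norm of
[\sum_i a i *: x (n_i)] is the supremum of [|\sum_i a i * p i|] over the
patterns [p = (x (n_1) w, x (n_2) w, and so on)] realized by points [w]. By
Ramsey's theorem ([homogeneous_subsequence]) there is a subsequence along which
the realized patterns of each length [k] are the same for all [k]-tuples far
enough out. Let [P] be the set of these patterns.

[P] is closed under passing to a subsequence of a pattern ([pattern_subseq]).
Weak nullness makes it closed under inserting zeros ([pattern_insert0]): if a
zero could not be inserted at some place, there would be points at which
arbitrarily long blocks of a fixed subsequence do not vanish, and a limit of
the evaluations at these points would be a functional bounded away from [0] on
that subsequence.

The spreading model is built on the set of infinite branches of [P], the
vector [coord i] being the [i]-th coordinate function in the bounded functions
on branches. Norms agree with those far out in the subsequence ([coord_norm]).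
Cutting a branch off after [n] terms gives a branch, and composing with this
truncation is the [n]-th basis projection, of norm at most one; thus the
coordinates form a basic sequence ([coord_basic]).

For nonreflexivity ([coord_nonreflexive]) there is a dichotomy. Either some
nonzero constant sequence is a branch, as for the basis of [l_1], or the
number of nonzero entries of patterns is bounded, as for the basis of [c_0].
In the first case the coordinates, in the second their partial sums, form a
bounded sequence whose pointwise limit along an ultrafilter is not well
approximated by its truncations. No element of the closed span has this
defect, whereas in a reflexive space the limit would belong to it. *)

(** * Bounded functions and their closed spans *)

Section evaluation.
Context (R : realType).

Lemma finite_set_normr_bounded (A : set R) : finite_set A ->
  exists C : R, 0 <= C /\ forall a, A a -> `|a| <= C.
Proof.
move=> /finite_seqP[s ->]; exists (\sum_(c <- s) `|c|); split => [|a /= sa].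
  by rewrite sumr_ge0.
by rewrite (big_rem _ sa) /= lerDl sumr_ge0.
Qed.

Lemma finite_set_gap (A : set R) : finite_set A ->
  exists2 d : R, 0 < d & forall a, A a -> a != 0 -> d <= `|a|.
Proof.
move=> /finite_seqP[s ->].
elim: s => [|a s [d d0 dP]]; first by exists 1.
exists (if a == 0 then d else Num.min d `|a|).
  by case: eqVneq => // a0; rewrite lt_min d0 normr_gt0.
move=> c /=; rewrite inE => /orP[/eqP -> a0|cs c0].
  by rewrite (negPf a0) ge_min lexx orbT.
by case: ifP => _; rewrite ?ge_min dP.
Qed.

Lemma linf_valP (O : Type) (a : R) (f g : linf O R) w :
  (a *: f + g) w = a * f w + g w.
Proof.
have -> : linf_val (a *: f + g) = a *: linf_val f + linf_val g.
  by rewrite -[LHS]/(\val _) linearP.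
by [].
Qed.

Lemma linf_val_sum (O : Type) n (a : 'I_n -> R) (f : 'I_n -> linf O R) w :
  (\sum_(i < n) a i *: f i) w = \sum_(i < n) a i * f i w.
Proof.
elim: n a f => [|n IH] a f; first by rewrite !big_ord0.
by rewrite !big_ord_recl linf_valP IH.
Qed.

Lemma subspace_valP (V : normedModType R) (X : closedSubspace V) (a : R)
    (u v : subspace_of X) :
  subspace_val (a *: u + v) = a *: subspace_val u + subspace_val v.
Proof. exact: (linearP (\val : subspace_of X -> V)). Qed.

Lemma subspace_val_sum (V : normedModType R) (X : closedSubspace V) n
    (a : 'I_n -> R) (f : 'I_n -> subspace_of X) :
  subspace_val (\sum_(i < n) a i *: f i) =
  \sum_(i < n) a i *: subspace_val (f i).
Proof.
elim: n a f => [|n IH] a f; first by rewrite !big_ord0.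
by rewrite !big_ord_recl subspace_valP IH.
Qed.

Lemma linf_valB (O : Type) (f g : linf O R) w : (f - g) w = f w - g w.
Proof.
rewrite (_ : f - g = -1 *: g + f) ?linf_valP ?mulN1r 1?addrC//.
by rewrite scaleN1r addrC.
Qed.

Lemma linf_dist_eval (O : Type) (f g : linf O R) w : `|f w - g w| <= `|f - g|.
Proof. by rewrite -linf_valB; exact: (linf_norm_ub (f - g)). Qed.

Lemma closure_span_approx (O : Type) (b : nat -> linf O R) v e :
  closure (linear_span b) v -> 0 < e ->
  exists n (a : nat -> R), forall w, `|v w - \sum_(i < n) a i * b i w| <= e.
Proof.
move=> vb e0; have [u [[n [a uE]] vu]] := vb _ (nbhsx_ballx v e e0).
exists n, a => w; rewrite -(linf_val_sum (fun i => a i) (fun i => b i)) -uE.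
by rewrite (le_trans (linf_dist_eval _ _ _))// ltW.
Qed.

(** Evaluations are continuous, so a linear relation between three of them
passes from the vectors [b i] to their closed span. *)
Lemma closure_span_identity (O : Type) (b : nat -> linf O R) (k : R) w1 w2 w3 :
  (forall i, b i w1 = b i w2 + k * b i w3) ->
  forall v, closure (linear_span b) v -> v w1 = v w2 + k * v w3.
Proof.
move=> bw v vb; apply/eqP; rewrite -subr_eq0 -normr_le0.
apply/ler_addgt0Pr => e e0.
rewrite add0r.
(* The three evaluation errors enter with weights 1, 1 and [|k|]. *)
set C : R := 2 + `|k|.
have C0 : 0 < C by rewrite ltr_pwDl.
have [n [a va]] := closure_span_approx vb (divr_gt0 e0 C0).
set S := fun w => \sum_(i < n) a i * b i w.
have SE : S w1 = S w2 + k * S w3.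
  rewrite /S mulr_sumr -big_split; apply: eq_bigr => i _ /=.
  by rewrite bw mulrDr mulrCA.
have -> : v w1 - (v w2 + k * v w3) =
    (v w1 - S w1) - (v w2 - S w2) - k * (v w3 - S w3) by rewrite SE; ring.
rewrite (le_trans (ler_normB _ _))// (_ : e = e / C + e / C + `|k| * (e / C)).
  rewrite lerD//; last by rewrite normrM ler_wpM2l// va.
  by rewrite (le_trans (ler_normB _ _))// lerD// va.
by rewrite -mulr2n -mulr_natl -mulrDl mulrC divfK// gt_eqF.
Qed.

End evaluation.

(** * Limits along ultrafilters *)

Lemma free_ultrafilter : exists U : set_system nat, UltraFilter U /\ \oo `<=` U.
Proof. exact: ultraFilterLemma. Qed.

Section functionals.
Context (R : realType).

Lemma ultra_bounded_cvg (U : set_system nat) (u : nat -> R) (C : R) :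
  UltraFilter U -> (forall n, `|u n| <= C) -> exists l : R, u @ U --> l.
Proof.
move=> UU uC.
have [|l [_ ul]] := @segment_compact R (- C) C (u @ U) _.
  by apply: (@filterE _ U) => n /=; rewrite in_itv /= -ler_norml.
exists l => N Nl; have [//|UN] := in_ultra_setVsetC (u @^-1` N) UU.
by have [r [nNr /nNr]] := ul (~` N) N UN Nl.
Qed.

Lemma ultra_eventually_cst (U : set_system nat) (u : nat -> R) N c l :
  UltraFilter U -> \oo `<=` U -> (forall n, (N <= n)%N -> u n = c) ->
  u @ U --> l -> l = c.
Proof.
move=> UU Uoo uc ul; apply: cvg_unique ul _ => //; apply: cvg_near_cst.
by apply: Uoo; exists N => // n /= /uc.
Qed.

Lemma bounded_scalar_dual (V : normedModType R) (g : V -> R) (M : R) :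
  scalar g -> (forall v, `|g v| <= M * `|v|) ->
  exists f : dual V, forall v, f v = g v.
Proof.
move=> gs gM; have gB v w : g v - g w = g (v - w).
  by rewrite (_ : v - w = -1 *: w + v) ?gs ?mulN1r 1?addrC// scaleN1r addrC.
suff gd : g \in @dual_pred R V by exists (Dual gd).
apply/asboolP; split => // v; apply/cvgrPdist_lt => e e0.
have M0 : 0 < `|M| + 1 by rewrite ltr_pwDr.
have : \forall w \near v, `|v - w| < e / (`|M| + 1).
  have /cvgrPdist_lt : w @[w --> v] --> v by exact: cvg_id.
  by apply; exact: divr_gt0.
apply: filterS => w; rewrite ltr_pdivlMr// gB; apply: le_lt_trans.
rewrite (le_trans (gM _))// mulrC ler_wpM2l//.
by rewrite (le_trans (ler_norm _))// lerDl.
Qed.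

(** Weak-star limits along an ultrafilter: bounded scalars converge along it by
compactness, and linearity and the bound pass to the limit. *)
Lemma ultra_limit_dual (U : set_system nat) (V : normedModType R)
    (g : nat -> V -> R) (M : R) : UltraFilter U ->
  (forall n, scalar (g n)) -> (forall n v, `|g n v| <= M * `|v|) ->
  exists f : dual V, forall v, g n v @[n --> U] --> f v.
Proof.
move=> UU gs gM.
have /choice[h hP] : forall v, exists l : R, g n v @[n --> U] --> l.
  by move=> v; exact: (ultra_bounded_cvg (C := M * `|v|)).
have hs : scalar h.
  move=> a u v; apply: (cvg_unique _ (hP _)) => //.
  rewrite (_ : (fun n => g n (a *: u + v)) = (fun n => a * g n u + g n v)).
    by apply: cvgD => //; apply: cvgMl_tmp.
  by apply/funext => n; rewrite gs.
have [|f fh] := bounded_scalar_dual (M := M) hs; last first.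
  by exists f => v; rewrite fh.
move=> v; apply: (closed_cvg (fun x : R => x <= M * `|v|) (@closed_le R _) _ _
  (cvg_norm (hP v))).
exact: filterE.
Qed.

(** Reflexivity enters only through this consequence: the limits of [f (y n)]
form an element of the bidual, so they are the values of one vector. *)
Lemma reflexive_ultra_limit (U : set_system nat) (V : normedModType R)
    (y : nat -> V) (M : R) : UltraFilter U ->
  reflexive_space V -> (forall n, `|y n| <= M) ->
  exists v : V, forall f : dual V, f (y n) @[n --> U] --> f v.
Proof.
move=> UU Vr yM.
have [| |phi phiP] := @ultra_limit_dual U (dual V) (fun n f => f (y n)) M UU.
- by move=> n a f g.
- move=> n f; rewrite (le_trans (dual_norm_ub f (y n)))// mulrC.
  by rewrite ler_wpM2r// dual_norm_ge0.
by have [v vP] := Vr phi; exists v => f; rewrite -vP.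
Qed.

End functionals.

(** * Ramsey's theorem for countably many colourings *)

Section ramsey.
Context (U : set_system nat) (UU : UltraFilter U) (Uoo : \oo `<=` U).

(** [Q] holds for [U]-almost all n_1, then for [U]-almost all n_2, and so on:
the ultrafilter verdict on the [j]-element extensions of [s]. *)
Fixpoint iter_near (Q : seq nat -> Prop) (j : nat) (s : seq nat) : Prop :=
  if j is i.+1 then \forall n \near U, iter_near Q i (rcons s n) else Q s.

Lemma iter_near_dec Q j s :
  iter_near Q j s \/ iter_near (fun s => ~ Q s) j s.
Proof.
elim: j s => [|j IH] s; first exact: EM.
have [|UnQ] := in_ultra_setVsetC [set n | iter_near Q j (rcons s n)] UU.
  by left.
by right; apply: filterS UnQ => n; have [] := IH (rcons s n).
Qed.

(** There are finitely many increasing sequences below [n], and each is the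
enumeration of a subset of ['I_n]. *)
Lemma near_sorted_seqs n (W : seq nat -> nat -> Prop) :
  (forall l, sorted ltn l -> all (fun i => (i < n)%N) l ->
    \forall x \near U, W l x) ->
  \forall x \near U, forall l, sorted ltn l -> all (fun i => (i < n)%N) l ->
    W l x.
Proof.
move=> UW.
pose L (B : {set 'I_n}) := [seq i <- iota 0 n | [exists j in B, val j == i]].
have sL B : sorted ltn (L B).
  by rewrite sorted_filter ?iota_ltn_sorted//; exact: ltn_trans.
have bL B : all (fun i => (i < n)%N) (L B).
  by apply/allP => i; rewrite mem_filter mem_iota => /andP[_ /andP[]].
have : \forall x \near U, forall B, W (L B) x.
  by apply: filter_forall => B; exact: UW.
apply: filterS => x Wx l sl bl.
rewrite (_ : l = L [set j : 'I_n | val j \in l]%SET)//.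
apply: (irr_sorted_eq ltn_trans ltnn) => // i.
rewrite mem_filter mem_iota /= add0n.
apply/idP/andP => [il|[/exists_inP[j]]]; last by rewrite inE => jl /eqP <-.
have ilt := allP bl _ il; split => //.
by apply/exists_inP; exists (Ordinal ilt); rewrite ?inE.
Qed.

(** The next term is chosen so that the verdict already reached on every
increasing tuple of earlier terms survives when the new term is appended.
Each such tuple excludes a set of candidates that is negligible for [U]. At
stage [n] only the [t] with [pickle t <= n] are taken into account, which
leaves finitely many conditions to meet. *)
Lemma ramsey_select (T : countType) (Q : T -> seq nat -> Prop) (k : T -> nat) :
  (forall t, iter_near (Q t) (k t) [::]) ->
  exists m : nat -> nat, {homo m : i j / (i < j)%N} /\
    forall t l, sorted ltn l -> all (fun i => (pickle t <= i)%N) l ->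
      size l = k t -> Q t (map m l).
Proof.
move=> Q0.
(* [l] lists positions in the initial segment [h] of the subsequence. *)
pose Inv (h : seq nat) := forall t l, sorted ltn l ->
  all (fun i => (pickle t <= i)%N) l -> all (fun i => (i < size h)%N) l ->
  (size l <= k t)%N -> iter_near (Q t) (k t - size l) (map (nth 0%N h) l).
have step h : exists n, Inv h ->
    Inv (rcons h n) /\ forall i, i \in h -> (i < n)%N.
  have [Ih|] := pselect (Inv h); last by exists 0%N.
  have UQ : \forall n \near U, forall l, sorted ltn l ->
      all (fun i => (i < size h)%N) l ->
      forall i : 'I_(size h).+1, forall t, unpickle i = Some t ->
      all (fun i => (pickle t <= i)%N) l -> (size l < k t)%N ->
      iter_near (Q t) (k t - (size l).+1) (rcons (map (nth 0%N h) l) n).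
    apply: near_sorted_seqs => l sl bl; apply: filter_forall => i.
    case: (unpickle _) => [t|]; last by apply: filterE.
    have [tl|] := boolP (all (fun i => (pickle t <= i)%N) l); last first.
      by move=> ntl; apply: filterE => n t' [<-]; rewrite (negPf ntl).
    have [lk|] := boolP (size l < k t)%N; last first.
      by move=> nlk; apply: filterE => n t' [<-] _; rewrite (negPf nlk).
    have := Ih t l sl tl bl (ltnW lk).
    rewrite -(subnSK lk) /=; apply: filterS => n W t' [<-] _ _ //.
  have Ubig : \forall n \near U, forall i, i \in h -> (i < n)%N.
    apply: Uoo; exists (\max_(i <- h) i).+1 => // n /= hn i ih.
    apply: leq_trans hn; rewrite ltnS.
    exact: (@leq_bigmax_seq _ _ (fun=> true) id).
  have [n [nQ nh]] := filter_ex (filterI UQ Ubig).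
  exists n => _; split=> // t l; case/lastP: l => [|l i].
    by move=> _ _ _ _; rewrite subn0; exact: Q0.
  rewrite sorted_pairwise; last exact: ltn_trans.
  rewrite pairwise_rcons !all_rcons !size_rcons.
  move=> /andP[li sl] /andP[ti tl] /andP[ih lh] lk.
  rewrite -sorted_pairwise in sl; last exact: ltn_trans.
  have lh' : all (fun i => (i < size h)%N) l.
    apply/allP => j jl; rewrite -ltnS; apply: leq_ltn_trans ih.
    exact: (allP li).
  have E : map (nth 0%N (rcons h n)) l = map (nth 0%N h) l.
    by apply/eq_in_map => j jl; rewrite nth_rcons (allP lh').
  rewrite map_rcons E; move: ih; rewrite ltnS leq_eqVlt => /orP[/eqP ih|ih].
    rewrite ih nth_rcons ltnn eqxx.
    have th : (pickle t < (size h).+1)%N by rewrite ltnS -ih.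
    by apply: (nQ l sl lh' (Ordinal th)) => //=; rewrite pickleK.
  rewrite nth_rcons ih -map_rcons -(size_rcons l i).
  apply: Ih; rewrite ?size_rcons ?all_rcons ?ti ?ih//.
  rewrite sorted_pairwise; last exact: ltn_trans.
  by rewrite pairwise_rcons li -sorted_pairwise //; exact: ltn_trans.
have [next nextP] := choice step.
pose H := fix H n := if n is i.+1 then rcons (H i) (next (H i)) else [::].
pose m n := next (H n).
have IH n : Inv (H n).
  elim: n => [|n /nextP[]//] t [|i l] _ _ // _ _.
  by rewrite subn0; exact: Q0.
have HE n : H n = mkseq m n by elim: n => [|n IHn] //; rewrite mkseqS -IHn.
exists m; split.
  apply: homo_ltn; first exact: ltn_trans.
  move=> n; have /nextP[_] := IH n.+1; apply.
  by rewrite /= mem_rcons inE eqxx.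
move=> t l sl tl lk.
pose n := (\max_(i <- l) i).+1.
have ln : all (fun i => (i < n)%N) l.
  apply/allP => i il; rewrite ltnS.
  exact: (@leq_bigmax_seq _ _ (fun=> true) id).
have := IH n t l sl tl; rewrite HE size_mkseq lk subnn => /(_ ln (leqnn _)) /=.
rewrite (_ : map _ l = map m l)//.
by apply/eq_in_map => i il; rewrite nth_mkseq// (allP ln).
Qed.

End ramsey.

(** Ramsey's theorem for countably many two-colourings of tuples at once, of
any arities. The colours cannot all be constant along one subsequence, so
the one for [t] is constant on the tuples that start beyond [pickle t]. *)
Lemma ramsey (T : countType) (Q : T -> seq nat -> Prop) (k : T -> nat) :
  exists m : nat -> nat, {homo m : i j / (i < j)%N} /\
    forall t, exists q : Prop, forall l, sorted ltn l ->
      all (fun i => (pickle t <= i)%N) l -> size l = k t ->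
      (Q t (map m l) <-> q).
Proof.
have [U [UU Uoo]] := free_ultrafilter.
pose d t : Prop := iter_near U (Q t) (k t) [::].
have dP t : iter_near U (fun s => Q t s <-> d t) (k t) [::].
  have mono (Q1 Q2 : seq nat -> Prop) j s : (forall s, Q1 s -> Q2 s) ->
      iter_near U Q1 j s -> iter_near U Q2 j s.
    move=> Q12; elim: j s => [|j IH] s /=; first exact: Q12.
    by apply: filterS => n; exact: IH.
  have [dt|ndt] := EM (d t).
    by apply: mono (dt) => s Qs; split.
  have [//|] := iter_near_dec UU (Q t) (k t) [::].
  by apply: mono => s nQ; split.
have [m [mm mQ]] := ramsey_select UU Uoo dP.
by exists m; split=> // t; exists (d t) => l sl tl lk; exact: mQ.
Qed.

(** * Patterns realized far out *)

Section patterns.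
Context (R : realType) (Omega : Type).

Definition realized (y : nat -> Omega -> R) (l : seq nat) (p : seq R) : Prop :=
  exists w, [seq y n w | n <- l] = p.

(** [P] is the set of patterns seen along [y] far out: the far tuples of
length [k] all realize the same ones. *)
Definition homogeneous (y : nat -> Omega -> R) (P : seq R -> Prop) : Prop :=
  forall k, exists N, forall l p, sorted ltn l -> all (fun i => (N <= i)%N) l ->
    size l = k -> size p = k -> (realized y l p <-> P p).

(** Only countably many patterns have values in a finite set, so Ramsey's
theorem settles all of them, and the finitely many of length [k] are settled
from a common index on. *)
Lemma homogeneous_subsequence (A : set R) (z : nat -> Omega -> R) :
  finite_set A -> (forall n w, A (z n w)) ->
  exists m : nat -> nat, {homo m : i j / (i < j)%N} /\
    exists P, homogeneous (fun n => z (m n)) P.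
Proof.
move=> /finite_seqP[s ->] zs.
have [m [mm /choice[q qP]]] := @ramsey (seq (seq_sub s))
  (fun t l => realized z l (map val t)) size.
exists m; split=> //; exists (fun p => exists2 t, map val t = p & q t) => k.
exists (\max_(t : k.-tuple (seq_sub s)) pickle (tval t)) => l p sl Nl lk pk.
have lt (t : seq (seq_sub s)) :
    size t = k -> all (fun i => (pickle t <= i)%N) l.
  move=> tk; apply: sub_all Nl => i; apply: leq_trans.
  have /eqP tk' := tk.
  exact: (@leq_bigmax _
    (fun t : k.-tuple (seq_sub s) => pickle (tval t)) (Tuple tk')).
have rE (p' : seq R) :
    realized (fun n => z (m n)) l p' <-> realized z (map m l) p'.
  by split => -[w wp]; exists w; rewrite -wp -map_comp.
split=> [[w wp]|[t tp qt]]; last first.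
  have tk : size t = k by rewrite -pk -tp size_map.
  by apply/rE; rewrite -tp; apply/(qP t); rewrite ?lt ?tk.
pose t := [seq (SeqSub (zs (m n) w) : seq_sub s) | n <- l].
have tp : map val t = p by rewrite -wp -map_comp.
have tk : size t = k by rewrite size_map.
exists t => //; apply/(qP t l); rewrite ?lt ?tk//.
by rewrite tp; apply/rE; exists w.
Qed.

Context (y : nat -> Omega -> R) (P : seq R -> Prop) (yP : homogeneous y P).

Lemma pattern_realized p N :
  P p -> exists2 l,
    [/\ sorted ltn l, all (fun i => (N <= i)%N) l & size l = size p]
    & realized y l p.
Proof.
move=> Pp; have [N' N'P] := yP (size p).
exists (iota (maxn N N') (size p)).
  split; [exact: iota_ltn_sorted| |by rewrite size_iota].
  by apply/allP => i; rewrite mem_iota geq_max => /andP[/andP[]].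
apply/N'P; rewrite ?size_iota ?iota_ltn_sorted//.
by apply/allP => i; rewrite mem_iota geq_max => /andP[/andP[]].
Qed.

Lemma pattern_subseq p q : subseq q p -> P p -> P q.
Proof.
move=> qp Pp; have [N NP] := yP (size q).
have [l [sl Nl lp] [w wp]] := pattern_realized N Pp.
have /subseqP[msk mp qE] := qp.
have ml : subseq (mask msk l) l by apply/subseqP; exists msk; rewrite // lp.
apply/(NP (mask msk l)) => //.
- exact: subseq_sorted ltn_trans _ _ ml sl.
- by apply/allP => i /(mem_subseq ml); exact: (allP Nl).
- by rewrite qE !size_mask ?lp.
- by exists w; rewrite map_mask wp.
Qed.

(** This is where weak nullness yields unconditionality. Realize [p] on a
first block, leave a gap of [L] indices, and realize [q] behind it, at a point
[w L]. If some member of the gap vanishes at [w L], then [0] can be inserted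
between [p] and [q]. So if the insertion is impossible, then for every [L] the
first [L] members of the infinite gap sequence are nonzero at [w L]. *)
Lemma pattern_insert0 p q :
  (forall (g : nat -> nat) (w : nat -> Omega), {homo g : i j / (i < j)%N} ->
     exists j L, (j < L)%N /\ y (g j) (w L) = 0) ->
  P (p ++ q) -> P (p ++ 0 :: q).
Proof.
move=> ynull Ppq; have [N NP] := yP (size (p ++ q)).
have [N' N'P] := yP (size (p ++ 0 :: q)).
pose M := maxn N N'; pose l1 := iota M (size p); pose M1 := (M + size p)%N.
pose l2 L := iota (M1 + L) (size q).
have fullE L : iota M (size p + (L + size q)) = l1 ++ (iota M1 L ++ l2 L).
  by rewrite 2!iotaD.
have far n l L : (n <= M)%N -> subseq l (iota M L) ->
    sorted ltn l /\ all (fun i => (n <= i)%N) l.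
  move=> nM lL; split.
    exact: (subseq_sorted ltn_trans lL (iota_ltn_sorted _ _)).
  apply/allP => i /(mem_subseq lL); rewrite mem_iota => /andP[Mi _].
  exact: leq_trans Mi.
have /choice[w wP] : forall L, exists w, [seq y n w | n <- l1 ++ l2 L] = p ++ q.
  move=> L.
  have [|s12 N12] :=
    @far N (l1 ++ l2 L) (size p + (L + size q))%N (leq_maxl _ _).
    by rewrite fullE cat_subseq// suffix_subseq.
  by apply/(NP (l1 ++ l2 L)) => //; rewrite !size_cat !size_iota.
have [|j [L [jL yj]]] := ynull (fun j => M1 + j)%N w.
  by move=> i i'; rewrite /= ltn_add2l.
have [|s12 N12] := @far N' (l1 ++ (M1 + j)%N :: l2 L)
    (size p + (L + size q))%N (leq_maxr _ _).
  rewrite fullE cat_subseq// -cat1s cat_subseq// sub1seq mem_iota.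
  by rewrite leq_addr ltn_add2l.
apply/(N'P (l1 ++ (M1 + j)%N :: l2 L)) => //.
  by rewrite !size_cat /= !size_iota.
exists (w L); have := wP L; rewrite !map_cat /= yj => /eqP.
by rewrite eqseq_cat ?size_map ?size_iota// => /andP[/eqP -> /eqP ->].
Qed.

Lemma pattern_in (A : set R) p c :
  (forall n w, A (y n w)) -> P p -> c \in p -> A c.
Proof.
move=> yA Pp; have [l _ [w <-]] := pattern_realized 0 Pp.
by move=> /mapP[n _ ->].
Qed.

Lemma pattern1_neq0 :
  (forall n, exists w, y n w != 0) -> exists2 c, c != 0 & P [:: c].
Proof.
move=> y0; have [N NP] := yP 1; have [w wN] := y0 N.
by exists (y N w) => //; apply/(NP [:: N]) => //=; [rewrite leqnn|exists w].
Qed.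

End patterns.

Section weak.
Context (R : realType).

(** Otherwise a limit of the evaluations at the points [w L] would be a
functional at least as large in absolute value on every [x (g j)] as the
smallest nonzero modulus in [A]. *)
Lemma weakly_null_vanishes (Omega : Type) (A : set R)
    (X : closedSubspace (linf Omega R)) (x : nat -> subspace_of X)
    (g : nat -> nat) (w : nat -> Omega) :
  finite_set A -> weakly_null x ->
  (forall n v, A (linf_val (subspace_val (x n)) v)) ->
  {homo g : i j / (i < j)%N} ->
  exists j L, (j < L)%N /\ linf_val (subspace_val (x (g j))) (w L) = 0.
Proof.
move=> Afin xnull xA gg; apply: contrapT => xn0.
have [d d0 dP] := finite_set_gap Afin.
have [U [UU Uoo]] := free_ultrafilter.
have [| |f fP] := @ultra_limit_dual R U (subspace_of X)
    (fun n v => linf_val (subspace_val v) (w n)) 1 UU.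
- by move=> n a u v; rewrite subspace_valP linf_valP.
- by move=> n v; rewrite mul1r; exact: (linf_norm_ub (subspace_val v)).
have fge j : d <= `|f (x (g j))|.
  apply: (closed_cvg (fun r : R => d <= r) (@closed_ge R d) _ _
    (cvg_norm (fP (x (g j))))).
  apply: Uoo; exists j.+1 => // n jn /=; apply: dP; first exact: xA.
  by apply/eqP => xz; apply: xn0; exists j, n.
have [N _ /(_ (g N))] := (cvgrPdist_lt _ _).1 (xnull f) d d0.
rewrite /= sub0r normrN ltNge fge => /(_ _)/notF; apply.
elim: N => // N IH; exact: leq_ltn_trans IH (gg _ _ (ltnSn N)).
Qed.

End weak.

(** * The spreading model as a space of functions on branches *)

Section model.
Context (R : realType) (A : set R) (P : seq R -> Prop) (h : R).
Context (A_finite : finite_set A) (P_in : forall p c, P p -> c \in p -> A c).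
Context (P_subseq : forall p q, subseq q p -> P p -> P q).
Context (P_insert0 : forall p q, P (p ++ q) -> P (p ++ 0 :: q)).
Context (h_neq0 : h != 0) (P_h : P [:: h]).

(** The patterns form a tree, and its infinite branches are the points on
which the spreading model lives as a space of functions. *)
Definition branch := {q : nat -> R | forall k, P (mkseq q k)}.
Definition branch_val (q : branch) : nat -> R := sval q.
Local Coercion branch_val : branch >-> Funclass.

Lemma pad0 p k : P p -> P (p ++ nseq k 0).
Proof.
move=> Pp; elim: k => [|k IH]; first by rewrite cats0.
exact: P_insert0.
Qed.

Lemma prepad0 p k : P p -> P (nseq k 0 ++ p).
Proof. by move=> Pp; elim: k => //= k IH; exact: (@P_insert0 [::]). Qed.

Lemma branch_of_subproof p : P p -> forall k, P (mkseq (nth 0 p) k).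
Proof.
move=> Pp k; apply: P_subseq (pad0 k Pp).
rewrite (_ : mkseq _ _ = take k (p ++ nseq k 0)) ?take_subseq//.
apply: (@eq_from_nth _ 0) => [|i].
  by rewrite size_mkseq size_takel// size_cat size_nseq leq_addl.
rewrite size_mkseq => ik; rewrite nth_mkseq// nth_take// nth_cat nth_nseq.
by case: ltnP => [//|pi]; rewrite nth_default// if_same.
Qed.

Definition branch_of p (Pp : P p) : branch :=
  exist _ (nth 0 p) (branch_of_subproof Pp).

Definition trunc n (q : branch) : branch := branch_of (svalP q n).

Lemma truncE n (q : branch) i : trunc n q i = if (i < n)%N then q i else 0.
Proof.
rewrite /trunc /branch_of /branch_val /=; case: ltnP => ni.
  by rewrite nth_mkseq.
by rewrite nth_default// size_mkseq.
Qed.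

Definition spike i : branch := branch_of (prepad0 i P_h).

Lemma spikeE i j : spike i j = if j == i then h else 0.
Proof.
rewrite /spike /branch_of /branch_val /= nth_cat size_nseq nth_nseq.
case: ltngtP => // [ij|->]; last by rewrite subnn.
by rewrite nth_default//= subn_gt0.
Qed.

Lemma branch_in (q : branch) i : A (q i).
Proof.
by apply: (P_in (svalP q i.+1)); rewrite mkseqS mem_rcons inE eqxx.
Qed.

Lemma coord_subproof i : (fun q : branch => q i) \in @bounded_pred branch R.
Proof.
have [C [_ AC]] := finite_set_normr_bounded A_finite.
by apply/bounded_predP; exists C => q; apply: AC; exact: branch_in.
Qed.

Definition coord i : linf branch R := Linf (coord_subproof i).

Lemma coordE i q : coord i q = q i. Proof. by []. Qed.

(** The finite combinations of the [coord i] with [i < n] do not distinguish a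
branch from its truncations beyond [n]; vectors of the closed span do so only
up to [e], uniformly over the branches. Convergence of the basis expansions and
nonreflexivity both rest on this. *)
Lemma span_trunc v e : closure (linear_span coord) v -> 0 < e ->
  exists n, forall m, (n <= m)%N -> forall q, `|v q - v (trunc m q)| <= e.
Proof.
move=> vb e0.
have [n [a va]] := closure_span_approx vb (divr_gt0 e0 (ltr0n R 2)).
exists n => m nm q; have := va (trunc m q).
have -> : \sum_(i < n) a i * coord i (trunc m q) = \sum_(i < n) a i * coord i q.
  by apply: eq_bigr => i _; rewrite !coordE truncE (leq_trans (ltn_ord i) nm).
rewrite distrC => va'; rewrite (splitr e).
set S : R := \sum_(i < n) _ in va'.
rewrite (_ : _ - _ = v q - S + (S - v (trunc m q))); last by ring.
by rewrite (le_trans (ler_normD _ _))// lerD// va.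
Qed.

(** The basis projections are composition with truncation, and the
coefficients are read off at the spikes. *)
Lemma partial_sum_trunc v n (q : branch) : closure (linear_span coord) v ->
  \sum_(i < n) v (spike i) / h * q i = v (trunc n q).
Proof.
move=> vb; elim: n => [|n IH].
  rewrite big_ord0; apply/esym.
  have : v (trunc 0 q) = v (trunc 0 q) + 1 * v (trunc 0 q); last by lra.
  apply: closure_span_identity vb => i.
  by rewrite coordE truncE ltn0 mulr0 addr0.
rewrite big_ord_recr /= IH.
rewrite (@closure_span_identity _ _ coord (q n / h)
  (trunc n.+1 q) (trunc n q) (spike n))//.
  by congr (_ + _); ring.
move=> i; rewrite !coordE !truncE spikeE ltnS leq_eqVlt.
by case: eqVneq => [->|_] /=; rewrite ?ltnn ?add0r ?divfK// mulr0 addr0.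
Qed.

Lemma coord_basic : basic_sequence coord.
Proof.
move=> v vb; exists (fun i => v (spike i) / h); split.
  apply/cvgrPdist_le => e e0; have [n nP] := span_trunc vb e0.
  exists n => // m nm; apply: linf_norm_le => [|q]; first exact: ltW.
  rewrite linf_valB /series /= big_mkord linf_val_sum partial_sum_trunc//.
  exact: nP.
move=> a av; apply/funext => i; apply: (mulIf h_neq0); rewrite divfK//.
apply/eqP; rewrite -subr_eq0 -normr_le0; apply/ler_addgt0Pr => e e0.
rewrite add0r; have [N _ NP] := (cvgrPdist_le _ _).1 av e e0.
have := NP (maxn N i.+1) (leq_maxl _ _).
apply: le_trans; apply: le_trans (linf_dist_eval _ _ (spike i)).
rewrite /series /= big_mkord linf_val_sum.
rewrite (bigD1 (Ordinal (leq_maxr N i.+1)))// coordE spikeE eqxx.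
rewrite big1 => [|j ji]; first by rewrite /= addr0.
by rewrite coordE spikeE ifN ?mulr0.
Qed.

(** When no nonzero value repeats arbitrarily often, patterns have boundedly
many nonzero entries: sum them value by value. *)
Lemma branch_sums_bounded :
  (forall c, c != 0 -> exists n, ~ P (nseq n c)) ->
  exists M, forall p, P p -> `|\sum_(c <- p) c| <= M.
Proof.
move=> Pn; have /finite_seqP[s sE] := A_finite.
suff [M MP] : exists M, forall p, P p -> {subset p <= s} ->
    `|\sum_(c <- p) c| <= M.
  by exists M => p Pp; apply: MP => // c cp; have := P_in Pp cp; rewrite sE.
elim: s {sE} => [|c s [M MP]].
  exists 0 => p _ /(_ _)p0; case: p p0 => [|c p] p0.
    by rewrite big_nil normr0.
  by have := p0 c (mem_head _ _).
have [n nP] : exists n : nat, forall k, P (nseq k c) -> `|c *+ k| <= `|c| *+ n.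
  have [->|c_neq0] := eqVneq c 0.
    by exists 0%N => k _; rewrite mul0rn normr0.
  have [n nP] := Pn c c_neq0; exists n => k kP; rewrite normrMn ler_wpMn2l//.
  rewrite leqNgt; apply/negP => nk; apply: nP; apply: P_subseq kP.
  by rewrite -(subnKC (ltnW nk)) nseqD prefix_subseq.
exists (`|c| *+ n + M) => p Pp ps.
rewrite (bigID (pred1 c)) /= (le_trans (ler_normD _ _))// lerD//.
  rewrite (eq_bigr (fun=> c)) ?big_const_seq; last by move=> i /eqP.
  rewrite iter_addr_0; apply: nP.
  rewrite -(_ : [seq i <- p | i == c] = nseq (count (pred1 c) p) c).
    exact: P_subseq (filter_subseq _ _) Pp.
  rewrite -size_filter; apply/all_pred1P; exact: filter_all.
rewrite -big_filter; apply: MP; first exact: P_subseq (filter_subseq _ _) Pp.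
by move=> i; rewrite mem_filter => /andP[/negPf ic /ps]; rewrite inE ic.
Qed.

Lemma reflexive_branch_limit (U : set_system nat) (y : nat -> linf branch R)
    (M : R) :
  UltraFilter U -> reflexive_space (subspace_of (closed_span coord)) ->
  (forall n, linear_span coord (y n)) -> (forall n, `|y n| <= M) ->
  exists2 v, closure (linear_span coord) v &
    forall q, y n q @[n --> U] --> v q.
Proof.
move=> UU refl yb yM.
have yin n : y n \in mem (subspace_set (closed_span coord)).
  by rewrite inE; exact: subset_closure.
have [v vP] :=
  @reflexive_ultra_limit R U _ (fun n => SubspaceOf (yin n)) M UU refl yM.
exists (subspace_val v); first by have := valP v; rewrite inE.
move=> q.
have [| |f fE] := @bounded_scalar_dual R (subspace_of (closed_span coord))
    (fun v => subspace_val v q) 1.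
- by move=> a u w; rewrite subspace_valP linf_valP.
- by move=> w; rewrite mul1r; exact: (linf_norm_ub (subspace_val w)).
have := vP f; rewrite fE; apply: cvg_trans; apply: near_eq_cvg.
by apply: nearW => n; rewrite fE.
Qed.

(** If a nonzero constant [c] is a branch, then the spreading model is of
[l_1] type; the limit of the [coord n] along an ultrafilter is [c] on
that branch and [0] on all its truncations. Otherwise it is of [c_0] type; the
sums of the first [n] vectors [coord i] are bounded, and their limit takes the
value [h] at [spike m] for every [m], but [0] at [trunc m (spike m)], the zero
branch. Either limit contradicts [span_trunc]. *)
Lemma coord_nonreflexive : ~ reflexive_space (subspace_of (closed_span coord)).
Proof.
move=> refl; have [U [UU Uoo]] := free_ultrafilter.
have not_small (c : R) : c != 0 -> ~ (`|c| <= `|c| / 2).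
  by rewrite -normr_gt0 => c_gt0; lra.
have [[c [c_neq0 Pc]]|Pn] := EM (exists c, c != 0 /\ forall n, P (nseq n c)).
  have Pcst k : P (mkseq (fun=> c) k).
    rewrite (_ : mkseq _ _ = nseq k c)//.
    elim: k => // k IH; rewrite mkseqS IH -cats1.
    by rewrite -[[:: c]]/(nseq 1 c) -nseqD addn1.
  pose cst : branch := exist _ (fun=> c) Pcst.
  have [M [M0 AM]] := finite_set_normr_bounded A_finite.
  have [| |v vb yv] := @reflexive_branch_limit U coord M UU refl.
  - move=> n; exists n.+1, (fun i => (i == n)%:R).
    rewrite (bigD1 ord_max)//= eqxx scale1r big1 ?addr0// => i.
    by rewrite -val_eqE /= => /negPf ->; rewrite scale0r.
  - by move=> n; apply: linf_norm_le => // q; apply: AM; exact: branch_in.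
  have c2 : 0 < `|c| / 2 by rewrite divr_gt0 ?normr_gt0.
  have [m /(_ m (leqnn m) cst)] := span_trunc vb c2.
  have -> : v cst = c by apply: (ultra_eventually_cst (N := 0) UU Uoo) (yv cst).
  have -> : v (trunc m cst) = 0.
    apply: (ultra_eventually_cst (N := m) UU Uoo) (yv (trunc m cst)) => n mn.
    by rewrite coordE truncE ltnNge mn.
  by rewrite subr0; exact: not_small.
have [|M MP] := branch_sums_bounded.
  by move=> c c_neq0; apply/existsNP => Pc; apply: Pn; exists c.
pose y n := \sum_(i < n) (1 : R) *: coord i.
have yE n q : y n q = \sum_(i < n) q i.
  by rewrite /y linf_val_sum; apply: eq_bigr => i _; rewrite mul1r.
have [| |v vb yv] := @reflexive_branch_limit U y M UU refl.
- by move=> n; exists n, (fun=> 1).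
- move=> n; apply: linf_norm_le => [|q].
    by rewrite (le_trans (normr_ge0 _) (MP _ P_h)).
  rewrite yE; have := MP _ (svalP q n).
  by rewrite /mkseq big_map -(big_mkord xpredT q) /index_iota subn0.
have c2 : 0 < `|h| / 2 by rewrite divr_gt0 ?normr_gt0.
have [m /(_ m (leqnn m) (spike m))] := span_trunc vb c2.
have -> : v (spike m) = h.
  apply: (ultra_eventually_cst (N := m.+1) UU Uoo) (yv (spike m)) => n mn.
  rewrite yE (bigD1 (Ordinal mn))// spikeE eqxx.
  rewrite big1 => [|i im]; first by rewrite /= addr0.
  by rewrite spikeE ifN.
have -> : v (trunc m (spike m)) = 0.
  apply: (ultra_eventually_cst (N := 0) UU Uoo) (yv _) => n _.
  rewrite yE big1// => i _; rewrite truncE spikeE.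
  by case: ltnP => // im; rewrite ifN// ltn_eqF.
by rewrite subr0; exact: not_small.
Qed.

(** Far out, both norms are suprema over the same finite set of patterns, so
they are equal and not merely close. *)
Lemma coord_norm (Omega : Type) (y : nat -> linf Omega R) :
  homogeneous (fun n w => y n w) P ->
  forall k, exists N, forall (a : 'I_k -> R) (j : 'I_k -> nat),
    {homo j : i i' / (i < i')%N} -> (forall i, (N <= j i)%N) ->
    `|\sum_(i < k) a i *: y (j i)| = `|\sum_(i < k) a i *: coord i|.
Proof.
move=> yP k; have [N NP] := yP k; exists N => a j jj Nj.
pose l := [seq j i | i <- enum 'I_k].
have lk : size l = k by rewrite size_map size_enum_ord.
have lE (i : 'I_k) : nth 0%N l i = j i.
  by rewrite (nth_map i) ?size_enum_ord// nth_ord_enum.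
have Nl : all (fun i => (N <= i)%N) l by apply/allP => _ /mapP[i _ ->].
have sl : sorted ltn l.
  rewrite sorted_map; have : sorted ltn (map val (enum 'I_k)).
    by rewrite val_enum_ord iota_ltn_sorted.
  by rewrite sorted_map; apply: sub_sorted => i i'; exact: jj.
apply/eqP; rewrite eq_le; apply/andP; split;
  apply: linf_norm_le => [|w]; rewrite ?normr_ge0//.
- have Pw : P [seq y n w | n <- l].
    by apply/(NP l) => //; [rewrite size_map|exists w].
  rewrite linf_val_sum; apply: (le_trans _
    (linf_norm_ub (\sum_(i < k) a i *: coord i) (branch_of Pw))).
  rewrite linf_val_sum le_eqVlt; apply/orP; left; apply/eqP; congr `|_|.
  apply: eq_bigr => i _; rewrite coordE /branch_val /= (nth_map 0%N) ?lE// lk.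
  exact: ltn_ord.
- have [w0 wq] := (NP l _ sl Nl lk (size_mkseq _ _)).2 (svalP w k).
  rewrite linf_val_sum; apply: (le_trans _
    (linf_norm_ub (\sum_(i < k) a i *: y (j i)) w0)).
  rewrite linf_val_sum le_eqVlt; apply/orP; left; apply/eqP; congr `|_|.
  apply: eq_bigr => i _; rewrite coordE /branch_val -lE.
  by rewrite -(nth_mkseq 0 (sval w) (ltn_ord i)) -wq (nth_map 0%N) ?lk.
Qed.

End model.

Theorem lemma4p5 (R : realType) (Omega : Type) (A : set R)
    (X : closedSubspace (linf Omega R)) (x : nat -> subspace_of X)
    (A_finite : finite_set A) (A0 : A 0)
    (x_normalized : forall n, `|x n| = 1)
    (x_weakly_null : weakly_null x)
    (x_in_A : forall n (w : Omega), A (linf_val (subspace_val (x n)) w)) :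
  exists m : nat -> nat, {homo m : i j / (i < j)%N} /\
    exists (E : completeNormedModType R) (b : nat -> E),
      generates_spreading_model (x \o m) b /\
      ~ reflexive_space (subspace_of (closed_span b)).
Proof.
have [m [mm [P yP]]] := @homogeneous_subsequence R Omega A
  (fun n w => linf_val (subspace_val (x n)) w) A_finite x_in_A.
exists m; split=> //.
have P_in p c : P p -> c \in p -> A c.
  by apply: (pattern_in yP) => n w; exact: x_in_A.
have P_insert0 p q : P (p ++ q) -> P (p ++ 0 :: q).
  apply: (pattern_insert0 yP) => g w gg.
  apply: (weakly_null_vanishes (g := m \o g) w A_finite x_weakly_null x_in_A).
  by move=> i j /gg /mm.
have [n|h h_neq0 Ph] := pattern1_neq0 yP.
  apply: contrapT => xn0.
  have : `|x (m n)| <= 0.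
    apply: (linf_norm_le (f := subspace_val (x (m n)))) => // w.
    rewrite normr_le0; apply/negPn/negP => xw; apply: xn0; by exists w.
  by rewrite x_normalized ler10.
have P_subseq := @pattern_subseq R Omega _ P yP.
exists (linf (branch P) R), (coord A_finite P_in); split; last first.
  exact: coord_nonreflexive P_subseq P_insert0 h_neq0 Ph.
split; first exact: coord_basic P_subseq P_insert0 h_neq0 Ph.
move=> k a eps eps0.
have [N NP] := @coord_norm R A P A_finite P_in P_subseq P_insert0 Omega
  (fun n => subspace_val (x (m n))) yP k.
exists N => j jj Nj; rewrite -(NP a j jj Nj).
rewrite (_ : `|\sum_(i < k) a i *: (x \o m) (j i)| =
  `|\sum_(i < k) a i *: subspace_val (x (m (j i)))|) ?subrr ?normr0//.
by rewrite -subspace_val_sum.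
Qed.
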